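(* Let $X_0$ be a Banach space and $A:D(A)\to X_0$ a (not necessarily densely defined) linear operator with $0\in\rho(A)$ such that $D(\underline{A})$ is dense in $\underline{X}_0$. (a) Let $n\in\mathbb{N}$. If $T\in\mathscr{L}(X_0)$ commutes with $A^{-1}$, then $T$ has a unique continuous extension to $\underline{X}_{-n}$, denoted by $\underline{T}_{-n}$. The operator $\underline{T}_{-n}$ is the restriction of $\underline{T}_{-n-1}$. The space $X_{-n}$ is invariant under $\underline{T}_{-n-1}$; its restriction to $X_{-n}$ is denoted by $T_{-n}$, and $T_{-n}\in\mathscr{L}(X_{-n})$. For all $k,n\in-\mathbb{N}$ the operators $\underline{T}_n$ and $\underline{T}_k$ are similar; the same holds for $T_n$ and $T_k$. (b) Let $\underline{T}\in\mathscr{L}(\underline{X}_0)$ be such that it leaves $D(A)$ invariant and commutes with $\underline{A}^{-1}=A^{-1}|_{\underline{X}_0}$. Then $\underline{T}_{-1}x=A\underline{T}A^{-1}x$ for each $x\in X_0$, where $\underline{T}_{-1}:\underline{X}_{-1}\to\underline{X}_{-1}$ is the unique continuous extension of $\underline{T}$, and as a consequence $\underline{T}_{-1}$ leaves $X_0$ invariant (and extends $\underline{T}$).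
   Context: $\|\cdot\|$ is the norm of $X_0$; $\underline{X}_0:=\overline{D(A)}$ with norm $\|\cdot\|$; $\underline{A}$ is the part of $A$ in $\underline{X}_0$, i.e. $D(\underline{A})=\{x\in D(A): Ax\in\underline{X}_0\}$. $\mathscr{L}(Z)$ denotes the bounded linear operators on a Banach space $Z$. Two operators $S\in\mathscr{L}(Z)$, $S'\in\mathscr{L}(Z')$ are similar if $S'=USU^{-1}$ for some Banach space isomorphism $U:Z\to Z'$. Level-zero operators ($\underline T_0:=T|_{\underline{X}_0}$, $T_0:=T$) are included in the similarity assertion. $\underline{X}_{-1}$ is the completion of $X_0$ for the norm $\|x\|_{\underline{X}_{-1}}:=\|A^{-1}x\|$ (under the density assumption it is also a completion of $\underline{X}_0$), and $\underline{A}_{-1}:\underline{X}_0\to\underline{X}_{-1}$ is the unique continuous extension of $A:(D(A),\|\cdot\|)\to(X_0,\|\cdot\|_{\underline{X}_{-1}})$, an isometric isomorphism. Recursively for $n\ge2$, $\underline{X}_{-n}$ is the completion of $\underline{X}_{-n+1}$ for $\|x\|_{\underline{X}_{-n}}:=\|\underline{A}_{-n+1}^{-1}x\|_{\underline{X}_{-n+1}}$, and $\underline{A}_{-n}:\underline{X}_{-n+1}\to\underline{X}_{-n}$ is the unique continuous extension of $\underline{A}_{-n+1}:\underline{X}_{-n+2}\to\underline{X}_{-n+1}$, an isometric isomorphism. Thus $\underline{X}_0\subseteq X_0\subseteq\underline{X}_{-1}\subseteq\underline{X}_{-2}\subseteq\cdots$. Recursively for $n\ge1$: $X_{-n}:=\underline{A}_{-n-1}(X_{-n+1})\subseteq\underline{X}_{-n-1}$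 with $\|x\|_{X_{-n}}:=\|\underline{A}_{-n-1}^{-1}x\|_{X_{-n+1}}$. *)

(* Defs.v *)
From HB Require Import structures.
From mathcomp Require Import all_boot all_order all_algebra.
From mathcomp Require Import all_classical all_reals all_analysis.

Set Implicit Arguments.
Unset Strict Implicit.
Unset Printing Implicit Defensive.

Import Order.TTheory GRing.Theory Num.Theory.
Import numFieldNormedType.Exports.

Local Open Scope classical_set_scope.
Local Open Scope ring_scope.

(** * Linear subspaces carrying their own norm *)

(* The norm need not be the restriction of a norm of [V]; only its values on
   the carrier matter. *)
Record normed_subspace (K : numFieldType) (V : lmodType K) := NormedSubspace {
  ns_set : set V;
  ns_norm : V -> K;
  ns_set0 : ns_set 0;
  ns_setP : forall (a : K) x y, ns_set x -> ns_set y -> ns_set (a *: x + y);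
  ns_normD : forall x y, ns_set x -> ns_set y ->
    ns_norm (x + y) <= ns_norm x + ns_norm y;
  ns_normZ : forall (a : K) x, ns_set x -> ns_norm (a *: x) = `|a| * ns_norm x;
  ns_norm_eq0 : forall x, ns_set x -> ns_norm x = 0 -> x = 0 }.

Section NormedSubspaceType.
Context (K : numFieldType) (V : lmodType K) (W : normed_subspace V).

Definition ns_pred : {pred V} := fun x => `[< ns_set W x >].

Record ns_type := NsType { ns_val : V; ns_valP : ns_val \in ns_pred }.

HB.instance Definition _ := [isSub for ns_val].
HB.instance Definition _ := [Choice of ns_type by <:].

Fact ns_pred_submod : submod_closed ns_pred.
Proof.
split; first exact/asboolP/ns_set0.
by move=> a x y /asboolP Wx /asboolP Wy; apply/asboolP/ns_setP.
Qed.

HB.instance Definition _ := GRing.isSubmodClosed.Build K V ns_pred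
  ns_pred_submod.
HB.instance Definition _ := [SubChoice_isSubLmodule of ns_type by <:].

Lemma ns_val_set (x : ns_type) : ns_set W (\val x).
Proof. exact/asboolP/(valP x). Qed.

Fact ns_type_normD (x y : ns_type) :
  ns_norm W (\val (x + y)) <= ns_norm W (\val x) + ns_norm W (\val y).
Proof. by rewrite raddfD; apply: ns_normD; exact: ns_val_set. Qed.

Fact ns_type_normZ (a : K) (x : ns_type) :
  ns_norm W (\val (a *: x)) = `|a| * ns_norm W (\val x).
Proof. by rewrite linearZ; apply: ns_normZ; exact: ns_val_set. Qed.

Fact ns_type_norm_eq0 (x : ns_type) : ns_norm W (\val x) = 0 -> x = 0.
Proof.
move=> /(ns_norm_eq0 (ns_val_set x)) x0.
by apply: val_inj; rewrite raddf0.
Qed.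

HB.instance Definition _ := Lmodule_isNormed.Build K ns_type
  ns_type_normD ns_type_normZ ns_type_norm_eq0.

Lemma ns_type_normE (x : ns_type) : `|x| = ns_norm W (\val x).
Proof. by []. Qed.

End NormedSubspaceType.

(** * Unbounded operators *)

(* Possibly not densely defined. [lo_fun] is a total function, but only its values on [lo_dom] matter. *)
Record linop (K : numFieldType) (X : normedModType K) := LinOp {
  lo_dom : set X;
  lo_fun :> X -> X;
  lo_dom0 : lo_dom 0;
  lo_domP : forall (a : K) x y, lo_dom x -> lo_dom y -> lo_dom (a *: x + y);
  lo_lin : forall (a : K) x y, lo_dom x -> lo_dom y ->
    lo_fun (a *: x + y) = a *: lo_fun x + lo_fun y }.

Section LinOp.
Context (K : numFieldType) (X : normedModType K) (A : linop X).

Definition resolvent_set : set K := [set l |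
  exists R : {linear X -> X}, [/\ continuous R,
    forall y, lo_dom A (R y) /\ l *: R y - A (R y) = y &
    forall x, lo_dom A x -> R (l *: x - A x) = x]].

Definition lo_inv : X -> X := 'pinv_(fun=> 0) (lo_dom A) A.

Fact lo_closure0 : closure (lo_dom A) 0.
Proof. exact/subset_closure/lo_dom0. Qed.

Fact lo_closureP (a : K) x y : closure (lo_dom A) x -> closure (lo_dom A) y ->
  closure (lo_dom A) (a *: x + y).
Proof.
move=> cx cy B.
have : {for (x, y), continuous (fun z : X * X => a *: z.1 + z.2)}.
  move=> z; apply: cvgD; last exact: cvg_snd.
  by apply: cvgZl_tmp; exact: cvg_fst.
move=> /[apply] -[[P Q]] /= [/cx[x' [Dx' Px']] /cy[y' [Dy' Qy']]] PQB.
exists (a *: x' + y'); split; first exact: lo_domP.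
exact: (PQB (x', y')).
Qed.

Definition lo_closure : normed_subspace X :=
  @NormedSubspace K X (closure (lo_dom A)) Num.norm lo_closure0 lo_closureP
    (fun x y _ _ => ler_normD x y) (fun a x _ => normrZ a x)
    (fun x _ => @normr0_eq0 _ _ x).

(* $\underline{X}_0$ *)
Definition Xu0 : normedModType K := ns_type lo_closure.

Definition part_dom : set Xu0 :=
  [set x | lo_dom A (\val x) /\ closure (lo_dom A) (A (\val x))].

Definition part_fun (x : Xu0) : Xu0 := insubd (0 : Xu0) (A (\val x)).

Lemma part_funE x : part_dom x -> \val (part_fun x) = A (\val x).
Proof. by case=> _ cAx; apply: insubdK; exact/asboolP. Qed.

Fact lo_fun0 : A 0 = 0.
Proof.
have := lo_lin 1 (lo_dom0 A) (lo_dom0 A).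
by rewrite !scale1r addr0 => /eqP; rewrite -subr_eq0 opprD addrA subrr sub0r oppr_eq0 => /eqP.
Qed.

Fact part_dom0 : part_dom 0.
Proof.
split; rewrite raddf0; first exact: lo_dom0.
by rewrite lo_fun0; exact: lo_closure0.
Qed.

Fact part_domP (a : K) x y :
  part_dom x -> part_dom y -> part_dom (a *: x + y).
Proof.
move=> [Dx cx] [Dy cy]; split; rewrite linearP; first exact: lo_domP.
by rewrite lo_lin//; exact: lo_closureP.
Qed.

Fact part_lin (a : K) x y : part_dom x -> part_dom y ->
  part_fun (a *: x + y) = a *: part_fun x + part_fun y.
Proof.
move=> Dx Dy; apply: val_inj.
rewrite part_funE; last exact: part_domP.
by rewrite !linearP /= (lo_lin _ Dx.1 Dy.1) !part_funE.
Qed.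

(* $\underline{A}$ *)
Definition part : linop Xu0 := LinOp part_dom0 part_domP part_lin.

(* $A^{-1}$ seen as a map $X_0 \to \underline{X}_0$; it takes values in $D(A)$
   as soon as $A$ is onto. *)
Definition lo_inv_Xu0 (x : X) : Xu0 := insubd (0 : Xu0) (lo_inv x).

End LinOp.

(** * The extrapolation spaces *)

(* [Y] together with the embedding [i] is a completion of [V] for the norm
   [N]. Completions being determined only up to a unique isometric isomorphism,
   a completion is given by its embedding rather than by an inclusion. *)
Definition is_completion (K : numFieldType) (V : lmodType K) (N : V -> K)
    (Y : completeNormedModType K) (i : {linear V -> Y}) :=
  (forall x, `|i x| = N x) /\ dense (range i).

Section TowerMaps.
Context (K : numFieldType) (X : normedModType K) (A : linop X).
Context (Y : nat -> completeNormedModType K).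
Context (e0 : {linear X -> Y 0%N}) (e : forall n, {linear Y n -> Y n.+1}).

(* [Y n] plays the role of $\underline{X}_{-n-1}$. *)
Definition Xu_of (n : nat) : normedModType K :=
  if n is m.+1 then Y m else Xu0 A.

Definition inclu_of (n : nat) : Xu_of n -> Y n :=
  match n with
  | 0%N => fun x : Xu0 A => e0 (\val x)
  | m.+1 => fun x : Y m => e m x
  end.

End TowerMaps.

(* That the [tw_A n] are isometric isomorphisms is not assumed: it follows when
   $0 \in \rho(A)$ and $D(\underline{A})$ is dense in $\underline{X}_0$. *)
Record tower (K : numFieldType) (X : normedModType K) (A : linop X) := Tower {
  tw_space : nat -> completeNormedModType K;
  tw_emb0 : {linear X -> tw_space 0%N};
  tw_emb : forall n, {linear tw_space n -> tw_space n.+1};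
  (* $\underline{A}_{-n-1} : \underline{X}_{-n} \to \underline{X}_{-n-1}$ *)
  tw_A : forall n, {linear Xu_of A tw_space n -> tw_space n};
  tw_completion0 : is_completion (fun x => `|lo_inv A x|) tw_emb0;
  tw_completion : forall n, is_completion
    (fun x => `|inclu_of tw_emb0 tw_emb ('pinv_(fun=> 0) setT (tw_A n) x)|)
    (tw_emb n);
  tw_A_continuous : forall n, continuous (tw_A n);
  tw_A0 : forall x : Xu0 A, lo_dom A (\val x) ->
    tw_A 0%N x = tw_emb0 (A (\val x));
  tw_AS : forall n (x : Xu_of A tw_space n),
    tw_A n.+1 (inclu_of tw_emb0 tw_emb x) = tw_emb n (tw_A n x) }.

Section Tower.
Context (K : numFieldType) (X : normedModType K) (A : linop X) (tw : tower A).

(* $\underline{X}_{-n}$ *)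
Definition Xu (n : nat) : normedModType K := Xu_of A (tw_space tw) n.

(* $\underline{X}_{-n} \subseteq \underline{X}_{-n-1}$ *)
Definition inclu (n : nat) : Xu n -> Xu n.+1 :=
  @inclu_of _ _ _ _ (tw_emb0 tw) (tw_emb tw) n.
Arguments inclu : clear implicits.

(* $\underline{A}_{-n-1}$ *)
Definition Au (n : nat) : {linear Xu n -> Xu n.+1} := tw_A tw n.

(* $X_0 \subseteq \underline{X}_{-n-1}$ *)
Fixpoint emb (n : nat) : X -> Xu n.+1 :=
  match n with
  | 0%N => fun x => tw_emb0 tw x
  | m.+1 => fun x => inclu m.+1 (emb m x)
  end.

(* $X_{-n} \subseteq \underline{X}_{-n-1}$ and its norm *)
Fixpoint Xset (n : nat) : set (Xu n.+1) :=
  match n with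
  | 0%N => range (tw_emb0 tw)
  | m.+1 => Au m.+1 @` @Xset m
  end.
Arguments Xset : clear implicits.

Fixpoint Xnorm (n : nat) : Xu n.+1 -> K :=
  match n with
  | 0%N => fun y => `|'pinv_(fun=> 0) setT (tw_emb0 tw) y|
  | m.+1 => fun y => Xnorm ('pinv_(fun=> 0) setT (Au m.+1) y)
  end.

(** [Xnorm] is a norm on [Xset]: this rests on [Au n] being isometric. *)

Section Facts.
Hypothesis A0 : resolvent_set A 0.
Hypothesis A_dense : dense (lo_dom (part A)).

Lemma lo_dom_inj : {in lo_dom A &, injective A}.
Proof.
case: A0 => R [_ _ RK] x y /set_mem Dx /set_mem Dy Axy.
by rewrite -(RK _ Dx) -(RK _ Dy) !scale0r Axy.
Qed.

Lemma lo_funK x : lo_dom A x -> lo_inv A (A x) = x.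
Proof. by move=> Dx; apply: pinvKV; [exact: lo_dom_inj|exact/mem_set]. Qed.

Lemma lo_dom_surj y : exists2 x, lo_dom A x & A x = y.
Proof.
case: A0 => R [_ RV _]; exists (- R y).
  have := lo_domP (- 1) (RV y).1 (lo_dom0 A).
  by rewrite scaleN1r addr0.
have := lo_lin (- 1) (RV y).1 (lo_dom0 A).
rewrite !scaleN1r !addr0 (lo_fun0 A) addr0 => ->.
by have [_] := RV y; rewrite scale0r sub0r.
Qed.

Lemma lo_invK y : lo_dom A (lo_inv A y) /\ A (lo_inv A y) = y.
Proof. by have [x Dx <-] := lo_dom_surj y; rewrite lo_funK. Qed.

Lemma emb0_inj : injective (tw_emb0 tw).
Proof.
move=> x y /eqP; rewrite -subr_eq0 -linearB -normr_eq0 (tw_completion0 tw).1.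
rewrite normr_eq0 => /eqP i0; apply/eqP; rewrite -subr_eq0.
by have [_ <-] := lo_invK (x - y); rewrite i0 (lo_fun0 A).
Qed.

Lemma dense_nbhs (Z : topologicalType) (S B : set Z) (x : Z) :
  dense S -> nbhs x B -> exists2 y, S y & B y.
Proof.
move=> dS; rewrite nbhsE => -[U [oU Ux] UB].
have [|y [Oy Sy]] := dS U _ oU; first by exists x.
by exists y => //; exact: UB.
Qed.

Lemma dense_isometric (Z Z' : normedModType K) (f : {linear Z -> Z'})
    (S : set Z) : dense S -> continuous f ->
  (forall x, S x -> `|f x| = `|x|) -> forall x, `|f x| = `|x|.
Proof.
move=> dS cf fS x; apply/eqP; rewrite -subr_eq0 -normr_le0.
apply/ler_addgt0Pl => _/posnumP[eps]; rewrite addr0.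
have e0 : 0 < eps%:num / 2 by rewrite divr_gt0.
have Nf := (cvgrPdist_lt _ _).1 (cf x) _ e0.
have Nx := (cvgrPdist_lt _ _).1 (@cvg_id _ (nbhs x)) _ e0.
have [y Sy [fxy xy]] := dense_nbhs dS (filterI (Nf _) (Nx _)).
have -> : `|f x| - `|x| = (`|f x| - `|f y|) + (`|y| - `|x|).
  by rewrite (fS _ Sy) addrA subrK.
rewrite (le_trans (ler_normD _ _))// (splitr eps%:num) lerD//.
  by rewrite (le_trans (ler_dist_dist _ _))// ltW.
by rewrite distrC (le_trans (ler_dist_dist _ _))// ltW.
Qed.

Lemma dense_inclu n : dense (range (inclu n)).
Proof.
case: n => [|n]; last exact: (tw_completion tw n).2.
move=> O [y Oy] oO.
have [_ [x _ <-] Ox] : exists2 z, range (tw_emb0 tw) z & O z.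
  by apply: (dense_nbhs (tw_completion0 tw).2 (x := y)); exact: open_nbhs_nbhs.
have [Di iK] := lo_invK x.
have Ci : lo_inv A x \in ns_pred (lo_closure A).
  exact/asboolP/subset_closure.
pose u : Xu0 A := NsType Ci.
have [r /= r0 xrO] : exists2 r, 0 < r & ball (tw_emb0 tw x) r `<=` O.
  by have /nbhs_ballP[r r0 rO] := open_nbhs_nbhs (conj oO Ox); exists r.
have [v [Dv cv] uv] :
    exists2 v, lo_dom (part A) v & ball u r v.
  by apply: dense_nbhs A_dense _; exact: nbhsx_ballx.
exists (tw_emb0 tw (A (\val v))); split.
  apply: xrO; rewrite -ball_normE /= -linearB (tw_completion0 tw).1.
  have DB : lo_dom A (\val u - \val v).
    rewrite addrC -scaleN1r; exact: lo_domP.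
  have -> : x - A (\val v) = A (\val u - \val v).
    have := lo_lin (- 1) Dv Di.
    by rewrite iK !scaleN1r ![- _ + _]addrC => <-.
  by rewrite lo_funK.
have Cv : A (\val v) \in ns_pred (lo_closure A) by exact/asboolP.
by exists (NsType Cv).
Qed.

Lemma Au_norm n (x : Xu n) : `|Au n x| = `|x|.
Proof.
elim: n x => [|n IHn].
  apply: (dense_isometric (S := lo_dom (part A))) => //.
    exact: (@tw_A_continuous _ _ _ tw 0%N).
  move=> x [Dx _]; rewrite [Au 0%N x](tw_A0 tw Dx) (tw_completion0 tw).1.
  by rewrite lo_funK// ns_type_normE.
apply: (dense_isometric (@dense_inclu n)).
  exact: (@tw_A_continuous _ _ _ tw n.+1).
have Au_inj : {in setT &, injective (Au n)}.
  move=> x y _ _ /eqP; rewrite -subr_eq0 -linearB -normr_eq0 IHn normr_eq0.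
  by rewrite subr_eq0 => /eqP.
move=> _ [x _ <-]; rewrite [Au n.+1 _](tw_AS x) (tw_completion tw n).1.
by congr `|_|; congr (inclu n _); apply: pinvKV; rewrite ?in_setT.
Qed.

Lemma Au_inj n : injective (Au n).
Proof.
move=> x y /eqP; rewrite -subr_eq0 -linearB -normr_eq0 Au_norm normr_eq0.
by rewrite subr_eq0 => /eqP.
Qed.

Lemma XnormS n (y : Xu n.+1) : Xnorm (Au n.+1 y) = Xnorm y.
Proof.
rewrite /=; congr Xnorm; apply: pinvKV; last exact: in_setT.
by move=> u v _ _; exact: Au_inj.
Qed.

(* $X_0 \to X_{-n}$, isometric and onto *)
Lemma Xset_iso (n : nat) : exists f : {linear X -> Xu n.+1},
  range f = Xset n /\ forall x, Xnorm (f x) = `|x|.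
Proof.
elim: n => [|n [f [fr fN]]].
  exists (tw_emb0 tw); split => // x /=.
  by rewrite pinvKV ?in_setT// => u v _ _; exact: emb0_inj.
exists (Au n.+1 \o f : {linear X -> Xu n.+2}); split => [|x].
  by rewrite /= -fr image_comp.
by rewrite -fN; exact: XnormS.
Qed.

Fact Xset0 n : Xset n 0.
Proof. by have [f [<- _]] := Xset_iso n; exists 0 => //; rewrite linear0. Qed.

Fact XsetP n (a : K) (x y : Xu n.+1) : Xset n x -> Xset n y -> Xset n (a *: x + y).
Proof.
have [f [<- _]] := Xset_iso n => -[u _ <-] [v _ <-].
by exists (a *: u + v) => //; rewrite linearP.
Qed.

Fact XnormD n (x y : Xu n.+1) : Xset n x -> Xset n y ->
  Xnorm (x + y) <= Xnorm x + Xnorm y.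
Proof.
have [f [<- fN]] := Xset_iso n => -[u _ <-] [v _ <-].
by rewrite -linearD !fN ler_normD.
Qed.

Fact XnormZ n (a : K) (x : Xu n.+1) : Xset n x -> Xnorm (a *: x) = `|a| * Xnorm x.
Proof.
have [f [<- fN]] := Xset_iso n => -[u _ <-].
by rewrite -linearZ !fN normrZ.
Qed.

Fact Xnorm_eq0 n (x : Xu n.+1) : Xset n x -> Xnorm x = 0 -> x = 0.
Proof.
have [f [<- fN]] := Xset_iso n => -[u _ <-].
by rewrite fN => /normr0_eq0 ->; rewrite linear0.
Qed.

Definition Xsub (n : nat) : normed_subspace (Xu n.+1) :=
  NormedSubspace (@Xset0 n) (@XsetP n) (@XnormD n) (@XnormZ n) (@Xnorm_eq0 n).

(* $X_{-n}$: the space [X] itself for [n = 0], and the set [Xset n] with the norm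
   [Xnorm] otherwise. *)
Definition Xm (n : nat) : normedModType K :=
  if n is m.+1 then ns_type (Xsub m.+1) else X.

Definition inclX (n : nat) : Xm n -> Xu n.+1 :=
  match n with
  | 0%N => fun x : X => tw_emb0 tw x
  | m.+1 => fun x : ns_type (Xsub m.+1) => \val x
  end.

End Facts.
End Tower.

Arguments Xu {K X A} tw n.
Arguments inclu {K X A} tw n x.
Arguments Au {K X A} tw n.
Arguments emb {K X A} tw n x.
Arguments Xset {K X A} tw n.
Arguments Xnorm {K X A} tw n y : rename.
Arguments Xm {K X A} tw A0 A_dense n.
Arguments inclX {K X A} tw A0 A_dense n x.

(** * Existence of a tower *)

(* The space $\underline{X}_0$, embedded into itself by $\underline{A}^{-1}$,
   is a completion at every level. *)
Section TowerExists.
Context (K : numFieldType) (X : completeNormedModType K) (A : linop X).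

Fact Xu0_complete (F : set_system (Xu0 A)) :
  ProperFilter F -> cauchy F -> cvg F.
Proof.
move=> FF /cauchyP Fc.
have /cauchy_cvg/cvg_ex[l Fl] : cauchy (\val @ F : set_system X).
  apply/cauchyP => e e0; have [x Fx] := Fc e e0.
  exists (\val x); change (F (\val @^-1` ball (\val x) e)).
  apply: filterS Fx => y; rewrite /preimage -!ball_normE /=.
  by rewrite ns_type_normE raddfB.
have cl : closure (lo_dom A) l.
  rewrite ((closure_id _).1 (@closed_closure _ (lo_dom A))).
  move=> B /Fl FB.
  have [x Bx] : exists x : Xu0 A, B (\val x) by exact: (filter_ex (F := F) FB).
  by exists (\val x); split => //; exact: (ns_val_set x).
have Cl : l \in ns_pred (lo_closure A) by exact/asboolP.
apply/cvg_ex; exists (NsType Cl); apply/cvgrPdist_lt => e e0.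
have /cvgrPdist_lt/(_ _ e0) := Fl; apply: filterS => x /=.
by rewrite ns_type_normE raddfB.
Qed.

Let Y : completeNormedModType K :=
  HB.pack (Xu0 A) (Uniform_isComplete.Build (Xu0 A) Xu0_complete).

Hypothesis A0 : resolvent_set A 0.
Hypothesis A_dense : dense (lo_dom (part A)).

Lemma lo_inv_lin (a : K) x y :
  lo_inv A (a *: x + y) = a *: lo_inv A x + lo_inv A y.
Proof.
have [Dx ix] := lo_invK A0 x; have [Dy iy] := lo_invK A0 y.
rewrite -[in LHS]ix -[in LHS]iy -lo_lin// lo_funK//; exact: lo_domP.
Qed.

Lemma lo_inv_Xu0E x : \val (lo_inv_Xu0 A x) = lo_inv A x.
Proof.
by apply: insubdK; apply/asboolP/subset_closure; case: (lo_invK A0 x).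
Qed.

Fact lo_inv_Xu0_linear : linear (lo_inv_Xu0 A).
Proof.
by move=> a x y; apply: val_inj; rewrite linearP /= !lo_inv_Xu0E lo_inv_lin.
Qed.

Let E0 : {linear X -> Y} :=
  HB.pack (lo_inv_Xu0 A : X -> Y)
    (GRing.isLinear.Build K X Y *:%R _ lo_inv_Xu0_linear).

Fact lo_inv_part_linear : linear (fun x : Xu0 A => lo_inv_Xu0 A (\val x)).
Proof. by move=> a x y; rewrite linearP /= lo_inv_Xu0_linear. Qed.

Let E : {linear Y -> Y} :=
  HB.pack ((fun x : Xu0 A => lo_inv_Xu0 A (\val x)) : Y -> Y)
    (GRing.isLinear.Build K Y Y *:%R _ lo_inv_part_linear).

Let I (n : nat) : {linear Xu_of A (fun=> Y) n -> Y} :=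
  match n with 0%N => idfun : {linear Y -> Y} | _.+1 => idfun : {linear Y -> Y} end.

Lemma E_range x : lo_dom (part A) x -> range E x.
Proof.
move=> [Dx cx].
have Cx : A (\val x) \in ns_pred (lo_closure A) by exact/asboolP.
exists (NsType Cx) => //; apply: val_inj.
by rewrite /= lo_inv_Xu0E lo_funK.
Qed.

Lemma E_dense : dense (range E).
Proof.
move=> O O0 oO; have [x [Ox Dx]] := A_dense O0 oO.
by exists x; split => //; exact: E_range.
Qed.

Lemma E0_dense : dense (range E0).
Proof.
move=> O O0 oO; have [z [Oz [x _ xz]]] := E_dense O0 oO.
by exists z; split => //; exists (\val x).
Qed.

Lemma pinv_idfun (y : Y) : 'pinv_(fun=> 0) setT (idfun : {linear Y -> Y}) y = y.
Proof. by apply: (@pinvKV _ _ _ setT idfun) => //; rewrite in_setT. Qed.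

Lemma tower_exists : inhabited (tower A).
Proof.
constructor.
refine (@Tower _ _ A (fun=> Y) E0 (fun=> E) I _ _ _ _ _).
- split; last exact: E0_dense.
  by move=> x; rewrite ns_type_normE /= lo_inv_Xu0E.
- move=> n; split; last exact: E_dense.
  by case: n => [|n] x; rewrite /I pinv_idfun.
- by case=> [|n] x; exact: cvg_id.
- by move=> x Dx; apply: val_inj; rewrite /= lo_inv_Xu0E lo_funK.
- by case.
Qed.

End TowerExists.

(** * Similarity and continuous extensions *)

Definition op_similar (K : numFieldType) (Z Z' : normedModType K)
    (S : Z -> Z) (S' : Z' -> Z') :=
  exists (U : {linear Z -> Z'}) (V : {linear Z' -> Z}),
    [/\ continuous U, continuous V, cancel U V, cancel V U &
        S' =1 U \o S \o V].

(* [S] is the only continuous map extending [T] along the embedding [i]. *)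
Definition unique_extension (Y Z : topologicalType) (i : Y -> Z)
    (T : Y -> Y) (S : Z -> Z) :=
  [/\ continuous S, forall y, S (i y) = i (T y) &
      forall S' : Z -> Z, continuous S' -> (forall y, S' (i y) = i (T y)) ->
        S' =1 S].

(* Main.v *)
From HB Require Import structures.
Require Import Defs.
From mathcomp Require Import all_boot all_order all_algebra.
From mathcomp Require Import all_classical all_reals all_analysis.

Import Order.TTheory GRing.Theory Num.Theory.
Import numFieldNormedType.Exports.

Local Open Scope classical_set_scope.
Local Open Scope ring_scope.

(** The isometry [Au n] has a complete, hence closed, range. The range is also
    dense, since it contains [X] if [n = 0] and, by induction,
    $\underline{X}_{-n}$ otherwise; so [Au n] is an isometric isomorphism. An
    operator on $\underline{X}_0$ can then be conjugated by the [Au n] to all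
    levels, which makes the similarity assertions automatic, and commutation
    with $A^{-1}$ says exactly that the conjugated operators extend one another
    along the inclusions. Likewise $X_{-n}$ is the isometric image of [X]
    under $\underline{A}_{-n-1} \cdots \underline{A}_{-2}$, which intertwines
    [T] and its conjugates. *)

(** * Linear isometries and maps with dense range *)

Lemma linear_isometry_continuous {K : numFieldType} {Z Z' : normedModType K}
    (f : {linear Z -> Z'}) : (forall x, `|f x| = `|x|) -> continuous f.
Proof.
move=> fN x; apply/cvgrPdist_lt => e e0.
apply: filterS (nbhsx_ballx x _ e0) => y.
by rewrite -ball_normE -linearB fN.
Qed.

(** Lets continuity of a map into $\underline{X}_0$ be tested in $X_0$. *)
Lemma comp_isometry_continuous {K : numFieldType} {W : topologicalType}
    {Z Z' : normedModType K} (i : {linear Z -> Z'}) (f : W -> Z) :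
  (forall x, `|i x| = `|x|) -> continuous (i \o f) -> continuous f.
Proof.
move=> iN cf x; apply/cvgrPdist_lt => e e0.
have nx := (cvgrPdist_lt _ _).1 (cf x) _ e0.
by apply: filterS (nx _) => y; rewrite /= -linearB iN.
Qed.

(** The preimages under [f] of the neighbourhoods of [y] generate a filter, proper by density and
    Cauchy because [f] is isometric; [f] sends its limit to [y]. Completeness is a hypothesis on
    filters because [Xu tw n] is typed only as a normed module. *)
Lemma dense_isometric_surj {K : numFieldType} {Z Z' : normedModType K}
    (f : {linear Z -> Z'}) :
  (forall F : set_system Z, ProperFilter F -> cauchy F -> cvg F) ->
  (forall x, `|f x| = `|x|) -> dense (range f) -> forall y, exists x, f x = y.
Proof.
move=> Zc fN df y.
pose F : set_system Z := filter_from (nbhs y) (fun U => f @^-1` U).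
have FF : ProperFilter F.
  apply: filter_from_proper.
    apply: filter_from_filter; first by exists setT; exact: filterT.
    by move=> U V nU nV; exists (U `&` V) => //; exact: filterI.
  move=> U nU; have [_ [x _ <-] Ux] := dense_nbhs df nU.
  by exists x.
have Fy : f @ F --> y by move=> U nU; exists U.
have Fc : cauchy F.
  apply/cauchyP => e e0.
  have e2 : 0 < e / 2 by rewrite divr_gt0.
  have nb := nbhsx_ballx y _ e2.
  have [_ [x _ <-] yx] := dense_nbhs df nb.
  exists x; exists (ball y (e / 2)) => // z yz.
  rewrite -ball_normE /= -fN linearB.
  have := ball_splitr yx yz.
  by rewrite -ball_normE.
have [z Fz] := (cvg_ex _).1 (Zc F FF Fc).
have Ffz : f @ F --> f z.
  exact: (cvg_comp _ _ Fz (linear_isometry_continuous f fN z)).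
by exists z; exact: (cvg_unique _ Ffz Fy).
Qed.

Lemma isometric_surj_inverse {K : numFieldType} {Z Z' : normedModType K}
    (f : {linear Z -> Z'}) :
  (forall x, `|f x| = `|x|) -> (forall y, exists x, f x = y) ->
  exists g : {linear Z' -> Z}, [/\ continuous g, cancel f g & cancel g f].
Proof.
move=> fN fS.
have fI : injective f.
  move=> x y /eqP; rewrite -subr_eq0 -linearB -normr_eq0 fN normr_eq0 subr_eq0.
  by move/eqP.
have [g gK] := choice fS.
have g_lin : linear g by move=> a x y; apply: fI; rewrite linearP !gK.
pose g' : {linear Z' -> Z} :=
  HB.pack g (GRing.isLinear.Build K Z' Z *:%R g g_lin).
exists g'; split => //; last by move=> x; apply: fI; rewrite gK.
by apply: linear_isometry_continuous => x; rewrite -fN gK.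
Qed.

Lemma dense_comp {Y1 Y2 Y3 : topologicalType} (i : Y1 -> Y2) (j : Y2 -> Y3) :
  continuous j -> dense (range i) -> dense (range j) -> dense (range (j \o i)).
Proof.
move=> cj di dj O O0 oO.
have [_ [/[swap] -[y _ <-] Oy]] := dj O O0 oO.
have oU : open (j @^-1` O) by apply: open_comp => // ? _; exact: cj.
have [|_ [/[swap] -[x _ <-] Ox]] := di _ _ oU; first by exists y.
by exists (j (i x)); split => //; exists x.
Qed.

Lemma dense_unique_extension {Y Z : topologicalType} (i : Y -> Z)
    (T : Y -> Y) (S : Z -> Z) : hausdorff_space Z -> dense (range i) ->
  continuous S -> (forall y, S (i y) = i (T y)) -> unique_extension i T S.
Proof.
move=> hZ di cS ST; split => // S' cS' S'T z.
apply: hZ => P Q nP nQ.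
have nPQ : nbhs z (S' @^-1` P `&` S @^-1` Q).
  by apply: filterI; [exact: cS'|exact: cS].
have [_ [y _ <-] [Py Qy]] := dense_nbhs di nPQ.
by exists (S (i y)); split => //; rewrite ST -S'T.
Qed.

(** * Similarity as an equivalence relation *)

Section OpSimilar.
Context {K : numFieldType}.

Lemma op_similar_refl (Z : normedModType K) (S : Z -> Z) : op_similar S S.
Proof.
exists (idfun : {linear Z -> Z}), (idfun : {linear Z -> Z}).
by split => // x; exact: cvg_id.
Qed.

Lemma op_similar_sym (Z Z' : normedModType K) (S : Z -> Z) (S' : Z' -> Z') :
  op_similar S S' -> op_similar S' S.
Proof.
move=> [U [V [cU cV UK VK SE]]]; exists V, U; split => // x.
by rewrite /= SE /= !UK.
Qed.

Lemma op_similar_trans (Z Z' Z'' : normedModType K) (S : Z -> Z)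
    (S' : Z' -> Z') (S'' : Z'' -> Z'') :
  op_similar S S' -> op_similar S' S'' -> op_similar S S''.
Proof.
move=> [U [V [cU cV UK VK SE]]] [U' [V' [cU' cV' UK' VK' SE']]].
exists (U' \o U : {linear Z -> Z''}), (V \o V' : {linear Z'' -> Z}).
split.
- by move=> x; apply: continuous_comp; [exact: cU|exact: cU'].
- by move=> x; apply: continuous_comp; [exact: cV'|exact: cV].
- by move=> x; rewrite /= UK' UK.
- by move=> x; rewrite /= VK VK'.
- by move=> x; rewrite SE' /= SE.
Qed.

End OpSimilar.

(** * The isometric isomorphisms between consecutive levels *)

Section TowerIso.
Context {K : numFieldType} {X : completeNormedModType K} {A : linop X}.
Context (A0 : resolvent_set A 0) (A_dense : dense (lo_dom (part A))).
Context (tw : tower A).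

Lemma lo_inv_continuous : continuous (lo_inv A).
Proof.
have [R [cR RV _]] := A0.
(* The resolvent at [0] inverts [0 - A], whence the sign. *)
suff -> : lo_inv A = (fun x => - R x) by move=> x; apply: cvgN; exact: cR.
apply/funext => x; have [DR AR] := RV x.
have DN : lo_dom A (- R x).
  by have := lo_domP (- 1) DR (lo_dom0 A); rewrite scaleN1r addr0.
rewrite -(lo_funK A0 DN); congr lo_inv.
have := lo_lin (- 1) DR (lo_dom0 A).
rewrite !scaleN1r !addr0 (lo_fun0 A) addr0 => ->.
by rewrite -[LHS]AR scale0r sub0r.
Qed.

(** The vector $A^{-1}x$ lies in $D(A)$ and [A] sends it back to $x \in \underline{X}_0$, so it
    belongs to the domain of the part. *)
Lemma lo_inv_partE (x : Xu0 A) : lo_inv (part A) x = lo_inv_Xu0 A (\val x).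
Proof.
set u := lo_inv_Xu0 A (\val x).
have [Di iK] := lo_invK A0 (\val x).
have Au : A (\val u) = \val x by rewrite lo_inv_Xu0E.
have Du : lo_dom (part A) u.
  by split; [rewrite lo_inv_Xu0E|rewrite Au; exact: (ns_val_set x)].
have <- : part A u = x by apply: val_inj; rewrite (part_funE Du).
apply: pinvKV; last exact/mem_set.
move=> v w /set_mem Dv /set_mem Dw vw; apply: val_inj.
apply: (lo_dom_inj A0); [exact/mem_set/Dv.1|exact/mem_set/Dw.1|].
by rewrite -(part_funE Dv) -(part_funE Dw); congr (\val _).
Qed.

Lemma Xu_complete n (F : set_system (Xu tw n)) :
  ProperFilter F -> cauchy F -> cvg F.
Proof.
case: n F => [|n] F FF Fc; first exact: Xu0_complete.
exact: (@cauchy_cvg (tw_space tw n)).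
Qed.

Lemma Au_emb0 (x : X) : Au tw 0 (lo_inv_Xu0 A x) = emb tw 0 x.
Proof.
have [Di iK] := lo_invK A0 x.
by rewrite [LHS](tw_A0 tw) lo_inv_Xu0E// iK.
Qed.

Lemma Au_surj n (y : Xu tw n.+1) : exists x, Au tw n x = y.
Proof.
elim: n y => [|n IHn]; apply: dense_isometric_surj.
- exact: Xu_complete.
- exact: Au_norm.
- move=> O O0 oO; have [_ [/[swap] -[x _ <-] Oz]] := (tw_completion0 tw).2 O O0 oO.
  exists (emb tw 0 x); split => //.
  by exists (lo_inv_Xu0 A x) => //; exact: Au_emb0.
- exact: Xu_complete.
- exact: Au_norm.
- move=> O O0 oO; have [_ [/[swap] -[x _ <-] Oz]] := (tw_completion tw n).2 O O0 oO.
  exists (tw_emb tw n x); split => //.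
  have [z <-] := IHn x.
  by exists (inclu tw n z) => //; exact: (tw_AS z).
Qed.

Lemma Au_iso n : exists g : {linear Xu tw n.+1 -> Xu tw n},
  [/\ continuous g, cancel (Au tw n) g & cancel g (Au tw n)].
Proof. by apply: isometric_surj_inverse; [exact: Au_norm|exact: Au_surj]. Qed.

Definition Auinv n := projT1 (cid (Au_iso n)).

Lemma AuK n : cancel (Au tw n) (Auinv n).
Proof. by rewrite /Auinv; case: cid => g []. Qed.

Lemma AuVK n : cancel (Auinv n) (Au tw n).
Proof. by rewrite /Auinv; case: cid => g []. Qed.

Lemma Auinv_continuous n : continuous (Auinv n).
Proof. by rewrite /Auinv; case: cid => g []. Qed.

Lemma Au_continuous n : continuous (Au tw n).
Proof. exact: (@tw_A_continuous _ _ _ tw n). Qed.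

Lemma Auinv_emb0 (x : X) : Auinv 0 (emb tw 0 x) = lo_inv_Xu0 A x.
Proof. by rewrite -Au_emb0 AuK. Qed.

(** This is [tw_AS] read at [Auinv n x]. Each inclusion is thus a conjugate of the preceding one,
    which drives the inductions over the levels. *)
Lemma incluS n (x : Xu tw n.+1) :
  inclu tw n.+1 x = Au tw n.+1 (inclu tw n (Auinv n x)).
Proof. by rewrite [RHS](tw_AS (Auinv n x)) -[in LHS](AuVK n x). Qed.

Lemma emb0_continuous : continuous (emb tw 0).
Proof.
move=> x; apply/cvgrPdist_lt => e e0.
(* The norm of $\underline{X}_{-1}$ on [X] is $\|A^{-1}\cdot\|$, so continuity of $A^{-1}$ is what
   is needed. *)
have nx := (cvgrPdist_lt _ _).1 (lo_inv_continuous x) _ e0.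
apply: filterS (nx _) => y.
rewrite -[emb tw 0 x - _](linearB (tw_emb0 tw)) (tw_completion0 tw).1.
suff -> : lo_inv A (x - y) = lo_inv A x - lo_inv A y by [].
by rewrite addrC -scaleN1r lo_inv_lin// scaleN1r addrC.
Qed.

Lemma inclu_continuous n : continuous (inclu tw n).
Proof.
elim: n => [|n IHn] x.
  apply: (@continuous_comp _ _ _ (\val : Xu0 A -> X) (emb tw 0)); last first.
    exact: emb0_continuous.
  exact: (linear_isometry_continuous (\val : {linear Xu0 A -> X})).
rewrite (funext (@incluS n)).
apply: (@continuous_comp _ _ _ (inclu tw n \o Auinv n) (Au tw n.+1)).
  by apply: continuous_comp; [exact: Auinv_continuous|exact: IHn].
exact: Au_continuous.
Qed.

Lemma dense_emb n : dense (range (emb tw n)).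
Proof.
elim: n => [|n IHn]; first exact: (tw_completion0 tw).2.
apply: (dense_comp (emb tw n) (inclu tw n.+1)) => //.
  exact: inclu_continuous.
exact: dense_inclu.
Qed.

(** * Conjugating an operator on $\underline{X}_0$ to all levels *)

Section Transport.
Context (S : {linear Xu0 A -> Xu0 A}).

Fixpoint transport n : {linear Xu tw n -> Xu tw n} :=
  match n with
  | 0%N => S
  | m.+1 => (Au tw m \o (transport m \o Auinv m) :
              {linear Xu tw m.+1 -> Xu tw m.+1})
  end.

Lemma transport_continuous n : continuous S -> continuous (transport n).
Proof.
move=> cS; elim: n => [//|n IHn] x.
apply: continuous_comp; last exact: Au_continuous.
by apply: continuous_comp; [exact: Auinv_continuous|exact: IHn].
Qed.

Lemma transport_Au n x : transport n.+1 (Au tw n x) = Au tw n (transport n x).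
Proof. by rewrite /= AuK. Qed.

Lemma transport_similar n : op_similar (transport 0) (transport n).
Proof.
elim: n => [|n IHn]; first exact: op_similar_refl.
apply: op_similar_trans IHn _; exists (Au tw n), (Auinv n); split => //.
- exact: Au_continuous.
- exact: Auinv_continuous.
- exact: AuK.
- exact: AuVK.
Qed.

(** By [incluS], the identity at one level is the preceding one conjugated by the [Au], so the
    lowest level decides. *)
Lemma transport_inclu n :
  (forall x, transport 1 (inclu tw 0 x) = inclu tw 0 (S x)) ->
  forall x, transport n.+1 (inclu tw n x) = inclu tw n (transport n x).
Proof.
move=> S1; elim: n => [//|n IHn] x.
by rewrite !incluS transport_Au IHn /= AuK.
Qed.

End Transport.

(** * The spaces $X_{-n}$ as isometric copies of $X_0$ *)

Fixpoint Xiso n : {linear X -> Xu tw n.+1} :=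
  match n with
  | 0%N => tw_emb0 tw
  | m.+1 => (Au tw m.+1 \o Xiso m : {linear X -> Xu tw m.+2})
  end.

Lemma range_Xiso n : range (Xiso n) = Xset tw n.
Proof. by elim: n => [//|n IHn] /=; rewrite -IHn image_comp. Qed.

Lemma Xnorm_Xiso n x : Xnorm tw n (Xiso n x) = `|x|.
Proof.
elim: n => [|n IHn]; last by rewrite -IHn; exact: XnormS.
by rewrite /= pinvKV ?in_setT// => u v _ _; exact: emb0_inj.
Qed.

Lemma Xm_iso n : exists (U : {linear X -> Xm tw A0 A_dense n})
    (V : {linear Xm tw A0 A_dense n -> X}),
  [/\ continuous U, continuous V, cancel U V, cancel V U &
      forall x, inclX tw A0 A_dense n (U x) = Xiso n x].
Proof.
(* [Xm] is defined by cases: at level [0] it is [X] itself, and the isomorphism is the identity. *)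
case: n => [|n].
  exists (idfun : {linear X -> X}), (idfun : {linear X -> X}).
  by split => // x; exact: cvg_id.
have XP x : Xiso n.+1 x \in ns_pred (Xsub tw A0 A_dense n.+1).
  have xX : range (Xiso n.+1) (Xiso n.+1 x) by exists x.
  by rewrite range_Xiso in xX; exact/asboolP.
pose u x : Xm tw A0 A_dense n.+1 := NsType (XP x).
have u_lin : linear u.
  by move=> a x y; apply: val_inj; exact: (linearP (Xiso n.+1) a x y).
pose U : {linear X -> Xm tw A0 A_dense n.+1} :=
  HB.pack u (GRing.isLinear.Build K X (Xm tw A0 A_dense n.+1) *:%R u u_lin).
have UN x : `|U x| = `|x| by rewrite ns_type_normE; exact: Xnorm_Xiso.
have US y : exists x, U x = y.
  have [x _ xy] : range (Xiso n.+1) (\val y).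
    by rewrite range_Xiso; exact: (ns_val_set y).
  by exists x; apply: val_inj.
have [V [cV UK VK]] := isometric_surj_inverse U UN US.
by exists U, V; split => //; exact: linear_isometry_continuous.
Qed.

(** Conjugating [T] by the isomorphism of [Xm_iso] gives continuity and similarity at once; the
    intertwining hypothesis identifies the result with the restriction of [S]. *)
Lemma Xm_transport n (T : {linear X -> X}) (S : Xu tw n.+1 -> Xu tw n.+1) :
  continuous T -> (forall x, S (Xiso n x) = Xiso n (T x)) ->
  exists T' : {linear Xm tw A0 A_dense n -> Xm tw A0 A_dense n},
    [/\ continuous T',
        forall x, inclX tw A0 A_dense n (T' x) = S (inclX tw A0 A_dense n x) &
        op_similar T T'].
Proof.
move=> cT ST; have [U [V [cU cV UK VK UE]]] := Xm_iso n.
exists (U \o (T \o V) : {linear _ -> _}); split; last by exists U, V.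
  move=> x; apply: continuous_comp; last exact: cU.
  by apply: continuous_comp; [exact: cV|exact: cT].
by move=> x; rewrite -[in RHS](VK x) !UE -ST.
Qed.

(** * From operators on $X_0$ to their extensions *)

(** For $x \in D(A)$, $Tx = TA^{-1}Ax = A^{-1}TAx$ is again in $D(A)$; continuity carries this
    invariance to the closure. *)
Lemma restriction_Xu0 (T : {linear X -> X}) : continuous T ->
  (forall x, T (lo_inv A x) = lo_inv A (T x)) ->
  exists S : {linear Xu0 A -> Xu0 A},
    continuous S /\ forall x, \val (S x) = T (\val x).
Proof.
move=> cT TA.
have TD x : lo_dom A x -> lo_dom A (T x).
  by move=> Dx; rewrite -(lo_funK A0 Dx) TA; have [] := lo_invK A0 (T (A x)).
have TC (x : Xu0 A) : T (\val x) \in ns_pred (lo_closure A).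
  apply/asboolP => B nB; have [y [Dy By]] := ns_val_set x _ (cT _ _ nB).
  by exists (T y); split => //; exact: TD.
pose s x : Xu0 A := NsType (TC x).
have s_lin : linear s.
  by move=> a x y; apply: val_inj; rewrite /= !linearP.
pose S : {linear Xu0 A -> Xu0 A} :=
  HB.pack s (GRing.isLinear.Build K (Xu0 A) (Xu0 A) *:%R s s_lin).
exists S; split => //.
apply: (comp_isometry_continuous (\val : {linear Xu0 A -> X})) => // x.
apply: (@continuous_comp _ _ _ (\val : Xu0 A -> X) T); last exact: cT.
exact: (linear_isometry_continuous (\val : {linear Xu0 A -> X})).
Qed.

End TowerIso.

Theorem proposition1p13 (K : numFieldType) (X : completeNormedModType K)
    (A : linop X) (A0 : resolvent_set A 0)
    (A_dense : dense (lo_dom (part A))) (tw : tower A) :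
  (forall T : {linear X -> X}, continuous T ->
    (forall x, T (lo_inv A x) = lo_inv A (T x)) ->
    exists (Tu : forall n, {linear Xu tw n -> Xu tw n})
      (Tm : forall n, {linear Xm tw A0 A_dense n -> Xm tw A0 A_dense n}),
      [/\ continuous (Tu 0%N) /\
            (forall x : Xu0 A, \val (Tu 0%N x : Xu0 A) = T (\val x)),
          forall x : X, Tm 0%N x = T x :> X,
          forall n, unique_extension (emb tw n) T (Tu n.+1),
          forall n x, Tu n.+1 (inclu tw n x) = inclu tw n (Tu n x) &
       [/\ forall n, Tu n.+1 @` Xset tw n `<=` Xset tw n,
          forall n, continuous (Tm n) /\
            (forall x, inclX tw A0 A_dense n (Tm n x) =
                       Tu n.+1 (inclX tw A0 A_dense n x)) &
          forall k n, op_similar (Tu k) (Tu n) /\ op_similar (Tm k) (Tm n)]]) /\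
  (forall T : {linear Xu0 A -> Xu0 A}, continuous T ->
    (forall x, lo_dom A (\val x) -> lo_dom A (\val (T x))) ->
    (forall x, T (lo_inv (part A) x) = lo_inv (part A) (T x)) ->
    exists T1 : {linear Xu tw 1 -> Xu tw 1},
      [/\ unique_extension (inclu tw 0) T T1,
          forall x : X, T1 (emb tw 0 x) =
            emb tw 0 (A (\val (T (lo_inv_Xu0 A x)))) &
          T1 @` range (emb tw 0) `<=` range (emb tw 0)]).
Proof.
split=> T cT.
- move=> TA; have [S [cS SE]] := restriction_Xu0 A0 T cT TA.
  pose Tu := transport A0 A_dense tw S.
  (* Written as images under [Au tw 0], the two sides are $TA^{-1}x$ and $A^{-1}Tx$. *)
  have Tu1 x : Tu 1%N (emb tw 0 x) = emb tw 0 (T x).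
    rewrite -[RHS](Au_emb0 A0) /= Auinv_emb0; congr (Au tw 0 _).
    by apply: val_inj; rewrite SE !lo_inv_Xu0E// TA.
  have Tu_inclu n x : Tu n.+1 (inclu tw n x) = inclu tw n (Tu n x).
    apply: transport_inclu => {}x.
    (* The inclusion of $\underline{X}_0$ factors through [emb tw 0], so [Tu1] covers the lowest
       level. *)
    by rewrite [LHS](Tu1 (\val x)) -SE.
  have Tu_emb n x : Tu n.+1 (emb tw n x) = emb tw n (T x).
    by elim: n => [|n IHn]; [exact: Tu1|rewrite [LHS]Tu_inclu IHn].
  have Tu_Xiso n x : Tu n.+1 (Xiso tw n x) = Xiso tw n (T x).
    elim: n => [|n IHn]; first exact: Tu1.
    by rewrite [LHS]transport_Au IHn.
  have Tu_similar n := transport_similar A0 A_dense tw S n.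
  have cTu n := transport_continuous A0 A_dense tw S n cS.
  pose TmP n := Xm_transport A0 A_dense tw n T (Tu n.+1) cT (Tu_Xiso n).
  exists Tu, (fun n => projT1 (cid (TmP n))); split.
  + by split; [exact: (cTu 0%N)|].
  + move=> x; case: cid => T' [_ T'E _] /=.
    (* The chosen operator is known only through [inclX], which at level [0] is the injective
       [tw_emb0]. *)
    by apply: (emb0_inj (tw := tw) A0); rewrite -[RHS]Tu1 -[RHS](T'E x).
  + move=> n; apply: dense_unique_extension.
    * exact: norm_hausdorff.
    * exact: dense_emb.
    * exact: cTu.
    * exact: Tu_emb.
  + exact: Tu_inclu.
  + split.
    * move=> n; rewrite -range_Xiso => _ [_ [x _ <-] <-].
      by exists (T x).
    * by move=> n; case: cid => T' [].
    (* All levels are compared with a common operator: [Tu 0] for the first family, [T] for the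
       second. *)
    * move=> k n; split.
        exact: op_similar_trans (op_similar_sym _ _ _ _ (Tu_similar k)) _.
      have Tm_similar m : op_similar T (projT1 (cid (TmP m))).
        by case: cid => T' [].
      exact: op_similar_trans (op_similar_sym _ _ _ _ (Tm_similar k)) _.
- move=> TD TA; pose T1 := transport A0 A_dense tw T 1%N.
  have T1E x : T1 (emb tw 0 x) = emb tw 0 (A (\val (T (lo_inv_Xu0 A x)))).
    (* Invariance of $D(A)$ keeps $TA^{-1}x$ in $D(A)$, where $\underline{A}_{-1}$ is given by
       [A]. *)
    rewrite /T1 /= Auinv_emb0 [LHS](tw_A0 tw)//; apply: TD.
    by rewrite lo_inv_Xu0E//; have [] := lo_invK A0 x.
  exists T1; split=> //; last by move=> _ [_ [x _ <-] <-]; rewrite T1E; exists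
    (A (\val (T (lo_inv_Xu0 A x)))).
  apply: dense_unique_extension.
  + exact: norm_hausdorff.
  + exact: dense_inclu.
  + exact: transport_continuous.
  (* On $\underline{X}_0$ commutation turns $ATA^{-1}x$ into $AA^{-1}Tx = Tx$. *)
  + move=> x; rewrite [LHS](T1E (\val x)) -lo_inv_partE// TA lo_inv_partE//.
    rewrite lo_inv_Xu0E//.
    by have [_ ->] := lo_invK A0 (\val (T x)).
Qed.
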